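(* Every finitely RC-presented monoid $T=\mathrm{MonRC}\langle A\mid u_i=v_i\ (i\in I)\rangle$ (with $A$ and $I$ finite and $u_i,v_i\in A^*$) is an RU-monoid.
   Context: $A^*$ denotes the free monoid on $A$. For a set $\mathfrak{R}\subseteq A^*\times A^*$ of defining relations, $\mathrm{MonRC}\langle A\mid\mathfrak{R}\rangle$ denotes $A^*/\mathfrak{R}^{\mathrm{RC}}$, where $\mathfrak{R}^{\mathrm{RC}}$ is the intersection of all congruences $\sigma$ of $A^*$ such that $\sigma\supseteq\mathfrak{R}$ and $A^*/\sigma$ is right cancellative (i.e. $xz=yz$ implies $x=y$). This is the greatest right cancellative image of $\mathrm{Mon}\langle A\mid\mathfrak{R}\rangle$. When $A$ and $\mathfrak{R}$ are both finite, the monoid $\mathrm{MonRC}\langle A\mid\mathfrak{R}\rangle$ is called finitely RC-presented. Let $\overline{A}=A\cup A^{-1}$, where $A^{-1}$ is a disjoint set of formal inverses of the letters of $A$, and extend $a\mapsto a^{-1}$ to words over $\overline{A}$ by $(a^{-1})^{-1}=a$ and $(a_1\cdots a_k)^{-1}=a_k^{-1}\cdots a_1^{-1}$. The free inverse monoid $FIM(A)$ is the quotient of $\overline{A}^*$ by the congruence generated by all pairs $(uu^{-1}u,u)$ and $(uu^{-1}vv^{-1},vv^{-1}uu^{-1})$ for $u,v\in\overline{A}^*$. $\mathrm{Inv}\langle A\mid u_i=v_i\ (i\in I)\rangle$ is the quotient of $FIM(A)$ by the congruence generated by the pairs $(u_i,v_i)$. A finitely presented special inverse monoid is one of the form $M=\mathrm{Inv}\langle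 A\mid w_i=1\ (i\in I)\rangle$ with $A$ and $I$ finite and $w_i\in\overline{A}^*$. Its submonoid of right units is $\{m\in M: mm^{-1}=1\}$. An RU-monoid is a monoid isomorphic to the submonoid of right units of some finitely presented special inverse monoid. *)

(* Defs.v *)
From HB Require Import structures.
From mathcomp Require Import all_boot.
From mathcomp Require Import boolp.

Set Implicit Arguments.
Unset Strict Implicit.
Unset Printing Implicit Defensive.

Local Open Scope group_scope.

Definition word (A : choiceType) : Type := seq A.
HB.instance Definition _ (A : choiceType) := Choice.on (word A).
HB.instance Definition _ (A : choiceType) :=
  isMonoid.Build (word A) (@catA A) (@cat0s A) (@cats0 A).

Record congruence (M : monoidType) := Congruence {
  cong_rel :> M -> M -> Prop;
  cong_refl : forall x, cong_rel x x;
  cong_sym : forall x y, cong_rel x y -> cong_rel y x;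
  cong_trans : forall x y z, cong_rel x y -> cong_rel y z -> cong_rel x z;
  cong_mul : forall x x' y y',
    cong_rel x x' -> cong_rel y y' -> cong_rel (x * y) (x' * y')
}.

Section QuotientMonoid.
Context {M : monoidType} (s : congruence M).

Definition cong_bool : rel M := fun x y => `[< s x y >].

Lemma cong_bool_equiv : equiv_class_of cong_bool.
Proof.
split=> [x | x y | y x z].
- exact/asboolP/cong_refl.
- by apply/asboolP/asboolP; apply: cong_sym.
- by move=> /asboolP xy /asboolP yz; apply/asboolP/(cong_trans xy yz).
Qed.

Canonical cong_equiv := EquivRelPack cong_bool_equiv.

Local Open Scope quotient_scope.

Definition quot_monoid : Type := {eq_quot cong_equiv}.

HB.instance Definition _ := Choice.on quot_monoid.
HB.instance Definition _ := EqQuotient.on quot_monoid.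

Definition proj (x : M) : quot_monoid := \pi_quot_monoid x.

Lemma projP x y : proj x = proj y <-> s x y.
Proof. by split=> [/eqmodP/asboolP | xy]; last exact/eqmodP/asboolP. Qed.

Lemma proj_repr (q : quot_monoid) : proj (repr q) = q.
Proof. exact: reprK. Qed.

Lemma proj_surj (q : quot_monoid) : exists x, q = proj x.
Proof. by exists (repr q); rewrite proj_repr. Qed.

Lemma repr_proj x : s (repr (proj x)) x.
Proof. by apply/projP; rewrite proj_repr. Qed.

Definition quot_mul : quot_monoid -> quot_monoid -> quot_monoid :=
  lift_op2 quot_monoid (@mul M).

Lemma quot_mulE x y : quot_mul (proj x) (proj y) = proj (x * y).
Proof.
by rewrite /quot_mul; unlock; apply/projP/cong_mul; apply: repr_proj.
Qed.

Lemma quot_mulA : associative quot_mul.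
Proof.
move=> p q r; have [x ->] := proj_surj p; have [y ->] := proj_surj q.
by have [z ->] := proj_surj r; rewrite !quot_mulE mulgA.
Qed.

Lemma quot_mul1 : left_id (proj 1) quot_mul.
Proof. by move=> p; have [x ->] := proj_surj p; rewrite quot_mulE mul1g. Qed.

Lemma quot_mulr1 : right_id (proj 1) quot_mul.
Proof. by move=> p; have [x ->] := proj_surj p; rewrite quot_mulE mulg1. Qed.

HB.instance Definition _ :=
  isMonoid.Build quot_monoid quot_mulA quot_mul1 quot_mulr1.

Lemma proj_is_morphism : monoid_morphism proj.
Proof. by split=> // x y; rewrite -quot_mulE. Qed.

End QuotientMonoid.

Section Intersection.
Context {M : monoidType} (P : congruence M -> Prop).

Definition cong_inter : congruence M := {|
  cong_rel := fun x y => forall s, P s -> s x y;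
  cong_refl := fun x s _ => cong_refl s x;
  cong_sym := fun x y xy s Ps => cong_sym (xy s Ps);
  cong_trans := fun x y z xy yz s Ps => cong_trans (xy s Ps) (yz s Ps);
  cong_mul := fun x x' y y' xx' yy' s Ps => cong_mul (xx' s Ps) (yy' s Ps)
|}.

End Intersection.

Definition contains (M : monoidType) (R : M -> M -> Prop) (s : congruence M) :=
  forall x y, R x y -> s x y.

Definition right_cancellative (M : monoidType) : Prop :=
  forall x y z : M, x * z = y * z -> x = y.

Definition cong_gen (M : monoidType) (R : M -> M -> Prop) : congruence M :=
  cong_inter (contains R).

Definition cong_RC (M : monoidType) (R : M -> M -> Prop) : congruence M :=
  cong_inter (fun s => contains R s /\ right_cancellative (quot_monoid s)).

Definition relations (I : Type) (M : monoidType) (u v : I -> M) :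
    M -> M -> Prop :=
  fun x y => exists i, x = u i /\ y = v i.

Definition MonRC (A : choiceType) (R : word A -> word A -> Prop) : Type :=
  quot_monoid (cong_RC R).
HB.instance Definition _ (A : choiceType) (R : word A -> word A -> Prop) :=
  Monoid.on (MonRC R).

(* The equational axiomatisation of inverse monoids: these identities force
   idempotents to commute, so that x^-1 is the unique y such that
   x * y * x = x and y * x * y = y. *)
HB.mixin Record StarMonoid_isInverse M of StarMonoid M := {
  mulgVg : forall x : M, x * x^-1 * x = x;
  mulgV_comm : forall x y : M,
    (x * x^-1) * (y * y^-1) = (y * y^-1) * (x * x^-1)
}.

#[short(type="inverseMonoidType")]
HB.structure Definition InverseMonoid :=
  {M of StarMonoid_isInverse M & StarMonoid M}.

Lemma mulVgV (M : inverseMonoidType) (x : M) : x^-1 * x * x^-1 = x^-1.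
Proof. by have:= mulgVg x^-1; rewrite invgK. Qed.

Lemma pseudo_inverse_unique (M : monoidType) (a b c : M) :
    a * b * a = a -> b * a * b = b -> a * c * a = a -> c * a * c = c ->
    (a * b) * (a * c) = (a * c) * (a * b) ->
    (b * a) * (c * a) = (c * a) * (b * a) ->
  b = c.
Proof.
move=> aba bab aca cac comm_l comm_r.
have bE : b * ((a * c) * (a * b)) = b.
  by rewrite [a * c * (a * b)]mulgA aca mulgA bab.
have cE : (c * a) * (b * a) * c = c.
  by rewrite -(mulgA c) (mulgA a) aba cac.
by rewrite -bE -comm_l !mulgA bab -[RHS]cE -comm_r -(mulgA (b * a)) cac.
Qed.

Lemma cong_inv (M : inverseMonoidType) (s : congruence M) (x y : M) :
  s x y -> s x^-1 y^-1.
Proof.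
move=> /projP xy; apply/projP; have [_ pM] := proj_is_morphism s.
apply: (@pseudo_inverse_unique _ (proj s x)).
- by rewrite -!pM mulgVg.
- by rewrite -!pM mulVgV.
- by rewrite xy -!pM mulgVg.
- by rewrite xy -!pM mulVgV.
- rewrite -(pM x x^-1) xy -(pM y y^-1) -!(pM (_ * _)).
  by rewrite mulgV_comm.
- rewrite -(pM x^-1 x) xy -(pM y^-1 y) -!(pM (_ * _)).
  by have:= mulgV_comm x^-1 y^-1; rewrite !invgK => ->.
Qed.

Section QuotientInverse.
Context {M : starMonoidType} (s : congruence M).
Hypothesis sV : forall x y, s x y -> s x^-1 y^-1.

Local Open Scope quotient_scope.

Definition quot_inv : quot_monoid s -> quot_monoid s :=
  lift_op1 (quot_monoid s) (@inv M).

Lemma quot_invE x : quot_inv (proj s x) = proj s x^-1.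
Proof. by rewrite /quot_inv; unlock; apply/projP/sV/repr_proj. Qed.

Lemma quot_invK : involutive quot_inv.
Proof. by move=> q; have [x ->] := proj_surj q; rewrite !quot_invE invgK. Qed.

Lemma quot_invM : {morph quot_inv : p q / p * q >-> q * p}.
Proof.
move=> p q; have [x ->] := proj_surj p; have [y ->] := proj_surj q.
have [_ pM] := proj_is_morphism s.
by rewrite -pM !quot_invE -pM invgM.
Qed.

End QuotientInverse.

Section QuotientInverseMonoid.
Context {M : inverseMonoidType} (s : congruence M).

HB.instance Definition _ := hasInv.Build (quot_monoid s) (@quot_inv M s).
HB.instance Definition _ := Monoid_isStarMonoid.Build (quot_monoid s)
  (quot_invK (@cong_inv M s)) (quot_invM (@cong_inv M s)).

Lemma proj_inv x : proj s x^-1 = (proj s x)^-1.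
Proof. by rewrite [RHS]quot_invE //; apply: cong_inv. Qed.

Lemma quot_mulgVg (p : quot_monoid s) : p * p^-1 * p = p.
Proof.
have [_ pM] := proj_is_morphism s; have [x ->] := proj_surj p.
by rewrite -proj_inv -!pM mulgVg.
Qed.

Lemma quot_mulgV_comm (p q : quot_monoid s) :
  (p * p^-1) * (q * q^-1) = (q * q^-1) * (p * p^-1).
Proof.
have [_ pM] := proj_is_morphism s.
have [x ->] := proj_surj p; have [y ->] := proj_surj q.
by rewrite -!proj_inv -!pM mulgV_comm.
Qed.

HB.instance Definition _ := StarMonoid_isInverse.Build (quot_monoid s)
  quot_mulgVg quot_mulgV_comm.

End QuotientInverseMonoid.

(* In the alphabet A + A, inl a stands for a and inr a for its formal
   inverse. *)
Definition bar_word (A : choiceType) : Type := word (A + A)%type.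
HB.instance Definition _ (A : choiceType) := Monoid.on (bar_word A).

Definition inv_letter (A : Type) (x : A + A) : A + A :=
  match x with inl a => inr a | inr a => inl a end.

Section FreeInverseMonoid.
Context {A : choiceType}.
Implicit Types u v : bar_word A.

Definition inv_word u : bar_word A := rev (map (@inv_letter A) u).

Lemma inv_wordK : involutive inv_word.
Proof. by move=> u; rewrite /inv_word map_rev revK mapK // => -[]. Qed.

Lemma inv_wordM : {morph inv_word : u v / u * v >-> v * u}.
Proof. by move=> u v; rewrite /inv_word map_cat rev_cat. Qed.

HB.instance Definition _ := hasInv.Build (bar_word A) inv_word.
HB.instance Definition _ :=
  Monoid_isStarMonoid.Build (bar_word A) inv_wordK inv_wordM.

Inductive FIM_relations : bar_word A -> bar_word A -> Prop :=
| FIM_regular u : FIM_relations (u * u^-1 * u) u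
| FIM_commute u v :
    FIM_relations ((u * u^-1) * (v * v^-1)) ((v * v^-1) * (u * u^-1)).

Definition FIM_cong : congruence (bar_word A) := cong_gen FIM_relations.

Lemma FIM_cong_inv u v : FIM_cong u v -> FIM_cong u^-1 v^-1.
Proof.
move=> uv s sP.
pose t := @Congruence (bar_word A) (fun x y => s x^-1 y^-1)
  (fun x => cong_refl s _) (fun x y => @cong_sym _ s _ _)
  (fun x y z => @cong_trans _ s _ _ _).
suff tM x x' y y' : s x^-1 x'^-1 -> s y^-1 y'^-1 -> s (x * y)^-1 (x' * y')^-1.
  apply: (uv (t tM)) => _ _ [x | x y] /=; apply: sP; rewrite !invgM !invgK.
    by rewrite mulgA -{2}[x]invgK; apply: FIM_regular.
  exact: FIM_commute.
by rewrite !invgM => xx' yy'; apply: cong_mul.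
Qed.

End FreeInverseMonoid.

Definition FIM (A : choiceType) : Type := quot_monoid (@FIM_cong A).

Section FIM_InverseMonoid.
Context {A : choiceType}.

HB.instance Definition _ := Monoid.on (FIM A).
HB.instance Definition _ := hasInv.Build (FIM A) (@quot_inv _ (@FIM_cong A)).
HB.instance Definition _ := Monoid_isStarMonoid.Build (FIM A)
  (quot_invK (@FIM_cong_inv A)) (quot_invM (@FIM_cong_inv A)).

Definition FIM_word (u : bar_word A) : FIM A := proj FIM_cong u.

Lemma FIM_word_mul (u v : bar_word A) :
  FIM_word (u * v) = FIM_word u * FIM_word v.
Proof. exact: (proj_is_morphism FIM_cong).2. Qed.

Lemma FIM_word_inv (u : bar_word A) : FIM_word u^-1 = (FIM_word u)^-1.
Proof. by rewrite [RHS]quot_invE //; apply: FIM_cong_inv. Qed.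

Lemma FIM_mulgVg (x : FIM A) : x * x^-1 * x = x.
Proof.
have [u ->] := proj_surj x; rewrite -!/(FIM_word u).
rewrite -FIM_word_inv -!FIM_word_mul.
by apply/projP => s; apply; apply: FIM_regular.
Qed.

Lemma FIM_mulgV_comm (x y : FIM A) :
  (x * x^-1) * (y * y^-1) = (y * y^-1) * (x * x^-1).
Proof.
have [u ->] := proj_surj x; have [v ->] := proj_surj y.
rewrite -!/(FIM_word _) -!FIM_word_inv -!FIM_word_mul.
by apply/projP => s; apply; apply: FIM_commute.
Qed.

HB.instance Definition _ :=
  StarMonoid_isInverse.Build (FIM A) FIM_mulgVg FIM_mulgV_comm.

End FIM_InverseMonoid.

Definition Inv (A : choiceType) (I : Type) (u v : I -> bar_word A) : Type :=
  quot_monoid (cong_gen (relations (FIM_word \o u) (FIM_word \o v))).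
HB.instance Definition _ (A : choiceType) (I : Type) (u v : I -> bar_word A) :=
  InverseMonoid.on (Inv u v).

Definition special_Inv (A : choiceType) (I : Type) (w : I -> bar_word A) :
    inverseMonoidType :=
  Inv w (fun=> 1).

Definition right_unit {M : inverseMonoidType} : {pred M} :=
  [pred m | m * m^-1 == 1].

Lemma right_unit_closed (M : inverseMonoidType) :
  monoid_closed (@right_unit M).
Proof.
split=> [|x y]; rewrite !inE; first by rewrite invg1 mulg1.
by move=> /eqP x1 /eqP y1; rewrite invgM -mulgA (mulgA y) y1 mul1g x1.
Qed.

Definition right_units (M : inverseMonoidType) : Type :=
  {m : M | m \in right_unit}.
HB.instance Definition _ (M : inverseMonoidType) :=
  SubChoice.on (right_units M).
HB.instance Definition _ (M : inverseMonoidType) :=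
  SubChoice_isSubMonoid.Build M right_unit (right_units M)
    (@right_unit_closed M).

Definition monoid_isomorphic (S T : monoidType) : Prop :=
  exists f : S -> T, monoid_morphism f /\ bijective f.

Definition RU_monoid (T : monoidType) : Prop :=
  exists (A I : finType) (w : I -> bar_word A),
    monoid_isomorphic T (right_units (special_Inv w)).

(* Main.v *)
Require Import Defs.
From mathcomp Require Import all_boot.

(** The special presentation is Inv< A | a a^-1 = 1, u_i v_i^-1 = 1 >, with
    inverse monoid M and T = MonRC< A | u_i = v_i >. Its relators make the
    letters right units and force u_i = v_i in M; as right units cancel on the
    right, a |-> a induces a morphism T -> M with values in the right units.
    Conversely, T being right cancellative, right translations are injective,
    so M acts on T by partial injections: this separates the images of the
    elements of T. If m is a right unit of M represented by w, then w is
    defined at 1, and following the path of w from 1 to t in the Cayley graph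
    of T shows that m is the image of t. *)

Set Implicit Arguments.
Unset Strict Implicit.
Unset Printing Implicit Defensive.

Local Open Scope group_scope.

Lemma MonRC_right_cancellative (A : choiceType) (R : word A -> word A -> Prop) :
  right_cancellative (MonRC R).
Proof.
move=> p q r; have [_ pM] := proj_is_morphism (cong_RC R).
have [x ->] := proj_surj p; have [y ->] := proj_surj q.
have [z ->] := proj_surj r.
rewrite -!pM => /projP xyz; apply/projP => s sP.
have [_ sM] := proj_is_morphism s; apply/projP/(sP.2 _ _ (proj s z)).
by rewrite -!sM; apply/projP/xyz.
Qed.

(** * Equality in inverse monoids given by presentations *)

Section InvWord.
Context {A : choiceType} {I : Type} (u v : I -> bar_word A).

Definition Inv_word (x : bar_word A) : Inv u v :=
  proj (cong_gen (relations (FIM_word \o u) (FIM_word \o v))) (FIM_word x).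

Lemma Inv_wordM : {morph Inv_word : x y / x * y}.
Proof.
by move=> x y; rewrite /Inv_word FIM_word_mul (proj_is_morphism _).2.
Qed.

Lemma Inv_wordV : {morph Inv_word : x / x^-1}.
Proof. by move=> x; rewrite /Inv_word FIM_word_inv proj_inv. Qed.

Lemma Inv_word_surj (m : Inv u v) : exists x, m = Inv_word x.
Proof.
by have [p ->] := proj_surj m; have [x ->] := proj_surj p; exists x.
Qed.

Lemma Inv_word_rel i : Inv_word (u i) = Inv_word (v i).
Proof. by apply/projP => s; apply; exists i. Qed.

(** Serves to separate elements of [Inv u v] by a congruence built directly on words. *)
Lemma Inv_word_eq (s : congruence (bar_word A)) (x y : bar_word A) :
    contains FIM_relations s -> contains (relations u v) s ->
  Inv_word x = Inv_word y -> s x y.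
Proof.
move=> sFIM srel /projP xy.
have sW (a b : bar_word A) : FIM_cong a b -> s a b by apply.
have reprW a : s (repr (FIM_word a)) a by apply/sW/repr_proj.
have reprM (p q : FIM A) : s (repr (p * q)) (repr p * repr q).
  apply/sW/projP; rewrite proj_repr (proj_is_morphism _).2.
  by rewrite !proj_repr.
(* Since [s] contains [FIM_cong], it descends to [FIM A], where it compares representatives. *)
pose t := @Congruence (FIM A) (fun p q => s (repr p) (repr q))
  (fun p => cong_refl s _) (fun p q => @cong_sym _ s _ _)
  (fun p q r => @cong_trans _ s _ _ _).
have tM (p p' q q' : FIM A) : s (repr p) (repr p') -> s (repr q) (repr q') ->
    s (repr (p * q)) (repr (p' * q')).
  move=> pp' qq'; apply: cong_trans (reprM p q) _.
  exact: cong_trans (cong_mul pp' qq') (cong_sym (reprM p' q')).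
have /= sxy := xy (t tM); apply: cong_trans (cong_sym (reprW x)) _.
apply: cong_trans (reprW y); apply: sxy => _ _ [i [-> ->]] /=.
apply: cong_trans (reprW (u i)) _; apply: cong_trans (cong_sym (reprW (v i))).
by apply: srel; exists i.
Qed.

End InvWord.

(** Allows a special relator to encode an equation between right units. *)
Lemma right_unit_eq (M : inverseMonoidType) (x y : M) :
  x * x^-1 = 1 -> y * y^-1 = 1 -> x * y^-1 = 1 -> x = y.
Proof.
move=> x1 y1 xy1; have yE : x * (y^-1 * y) = y by rewrite mulgA xy1 mul1g.
have yx1 : y * x^-1 = 1 by rewrite -[y * x^-1]invgK invgM invgK xy1 invg1.
(* The idempotents x^-1 x and y^-1 y commute. *)
have := mulgV_comm x^-1 y^-1; rewrite !invgK => comm.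
rewrite -yE -[RHS]mul1g -{1}x1 -(mulgA x) (mulgA x^-1) comm.
by rewrite -(mulgA y^-1) (mulgA y) yx1 mul1g mulgA xy1 mul1g.
Qed.

(** * Words acting on a right cancellative monoid by partial injections *)

Section PartialAction.
Context {A : choiceType} {T : monoidType} (g : A -> T).
Hypothesis T_rc : right_cancellative T.

(** [w] labels a path from [x] to [y] in the right Cayley graph of [T], inverse letters running
    backwards along edges. It is a relation because such an edge need not exist. *)
Fixpoint act (w : seq (A + A)) (x y : T) : Prop :=
  match w with
  | [::] => x = y
  | inl a :: w' => act w' (x * g a) y
  | inr a :: w' => exists2 z, z * g a = x & act w' z y
  end.

Lemma act_cat w w' x y :
  act (w ++ w') x y <-> exists2 z, act w x z & act w' z y.
Proof.
elim: w x => [|[a|a] w IHw] x /=.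
- by split=> [|[z ->]] //; exists x.
- exact: IHw.
- split=> [[t tx /IHw[z wz w'z]]|[z [t tx wz] w'z]].
    by exists z => //; exists t.
  by exists t => //; apply/IHw; exists z.
Qed.

Lemma act_inv (w : bar_word A) x y : act w^-1 x y <-> act w y x.
Proof.
have catV (c : A + A) (s : seq (A + A)) :
    inv_word (c :: s) = inv_word s ++ [:: inv_letter c].
  by rewrite /inv_word /= rev_cons cats1.
rewrite -[w^-1]/(inv_word w).
elim: w x y => [|[a|a] w IHw] x y;
  rewrite ?catV ?act_cat /=.
- by split.
- split=> [[z /IHw wz [t ty tx]]|wx]; first by rewrite -tx ty in wz *.
  by exists (y * g a); [apply/IHw | exists y].
- split=> [[z /IHw wz zy]|[z zy wz]]; exists z => //.
  by apply/IHw.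
Qed.

(** Only an inverse letter could branch, and right cancellation leaves at most one [z] with
    [z * g a = x]. *)
Lemma act_fun w x y z : act w x y -> act w x z -> y = z.
Proof.
elim: w x => [|[a|a] w IHw] x /=; first by move=> -> ->.
  exact: IHw.
by move=> [s sx ws] [t]; rewrite -sx => /T_rc ->; apply: IHw.
Qed.

(** These partial identities yield both relations of [FIM A]: they commute, and applying the one of
    [w] before [w] changes nothing. *)
Lemma act_idem (w : bar_word A) x y :
  act (w * w^-1) x y <-> x = y /\ exists z, act w x z.
Proof.
rewrite act_cat; split=> [[z wx /act_inv wy]|[<- [z wz]]].
  split; last by exists z.
  move/act_inv: wx => wx; move/act_inv: wy => wy; exact: act_fun wx wy.
by exists z => //; apply/act_inv.
Qed.

Definition act_cong : congruence (bar_word A).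
Proof.
exists (fun w w' => forall x y, act w x y <-> act w' x y).
- by [].
- by move=> w w' ww' x y; rewrite ww'.
- by move=> w1 w2 w3 e12 e23 x y; rewrite e12.
- move=> w1 w1' w2 w2' e1 e2 x y; rewrite !act_cat.
  by split=> -[z /e1 wz /e2 zw]; exists z.
Defined.

Lemma act_cong_FIM : contains FIM_relations act_cong.
Proof.
move=> _ _ [w | w w'] x y.
  rewrite act_cat; split=> [[z /act_idem[<-]] //|wy].
  by exists x => //; apply/act_idem; split=> //; exists y.
rewrite !act_cat; split=> -[z /act_idem[<- wx] /act_idem[<- w'x]].
  by exists x; apply/act_idem.
by exists x; apply/act_idem.
Qed.

End PartialAction.

(** * The special presentation and its right units *)

Section SpecialPresentation.
Context {A I : finType} (u v : I -> word A).

Let T : monoidType := MonRC (relations u v).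
Let cls (x : word A) : T := proj (cong_RC (relations u v)) x.
Let gen (a : A) : T := cls [:: a].

Let pos (x : word A) : bar_word A := map inl x.

Definition RU_relator (k : A + I) : bar_word A :=
  match k with
  | inl a => pos [:: a] * (pos [:: a])^-1
  | inr i => pos (u i) * (pos (v i))^-1
  end.

Let M : inverseMonoidType := special_Inv RU_relator.
Let W (x : bar_word A) : M := Inv_word RU_relator (fun=> 1) x.

Let clsM x y : cls (x ++ y) = cls x * cls y.
Proof. exact: (proj_is_morphism _).2. Qed.

Let cls_surj (t : T) : exists x, t = cls x.
Proof. exact: proj_surj. Qed.

Let T_rc : right_cancellative T.
Proof. exact: MonRC_right_cancellative. Qed.

Let WM : {morph W : x y / x * y}.
Proof. exact: Inv_wordM. Qed.

Let WV : {morph W : x / x^-1}.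
Proof. exact: Inv_wordV. Qed.

Let posM x y : pos (x ++ y) = pos x * pos y.
Proof. exact: map_cat. Qed.

Lemma act_pos x p q : act gen (pos x) p q <-> p * cls x = q.
Proof.
elim: x p => [|a x IHx] p /=; first by rewrite mulg1.
by rewrite IHx -mulgA -clsM.
Qed.

Lemma act_cong_RU_relator :
  contains (relations RU_relator (fun=> 1)) (act_cong gen).
Proof.
(* Both kinds of relator have this shape, [inl a] with [x] and [y] equal to [[:: a]]. Right
   translations are total, so undoing one gives the identity on all of [T]. *)
have eq_act x y : cls x = cls y -> act_cong gen (pos x * (pos y)^-1) 1.
  move=> xy p q; rewrite act_cat /=; split=> [[z]|->].
    by move=> /act_pos <- /act_inv/act_pos; rewrite xy => /T_rc.
  by exists (q * cls x); [apply/act_pos | apply/act_inv/act_pos; rewrite xy].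
move=> _ _ [[a|i] [-> ->]]; apply: eq_act => //.
by apply/projP => s [+ _]; apply; exists i.
Qed.

Lemma W_pos_right_unit x : W (pos x) * (W (pos x))^-1 = 1.
Proof.
elim: x => [|a x IHx]; first by rewrite -WV -WM.
rewrite -cat1s posM WM invgM -mulgA (mulgA (W (pos x))) IHx mul1g.
by rewrite -WV -WM; apply: (Inv_word_rel RU_relator (fun=> 1) (inl a)).
Qed.

(** The kernel of the map from [x] to [W (pos x)], meant as one of the congruences intersected in
    [cong_RC]. *)
Definition pos_cong : congruence (word A).
Proof.
exists (fun x y => W (pos x) = W (pos y)) => //.
- by move=> x y z -> ->.
- by move=> x x' y y' xx' yy'; rewrite !posM !WM xx' yy'.
Defined.

Lemma pos_cong_contains : contains (relations u v) pos_cong.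
Proof.
move=> _ _ [i [-> ->]]; apply: right_unit_eq; try exact: W_pos_right_unit.
by rewrite -WV -WM; apply: (Inv_word_rel RU_relator (fun=> 1) (inr i)).
Qed.

Lemma pos_cong_right_cancellative : right_cancellative (quot_monoid pos_cong).
Proof.
move=> p q r; have [_ pM] := proj_is_morphism pos_cong.
have [x ->] := proj_surj p; have [y ->] := proj_surj q.
have [z ->] := proj_surj r; rewrite -!pM => /projP /= xyz.
(* The right unit [W (pos z)] is cancelled by its inverse on the right. *)
apply/projP => /=; rewrite -[LHS]mulg1 -[RHS]mulg1 -(W_pos_right_unit z).
by rewrite !mulgA -!WM -!posM; congr (_ * _).
Qed.

Lemma W_pos_cls x y : cls x = cls y -> W (pos x) = W (pos y).
Proof.
move=> /projP xy; apply: (xy pos_cong); split.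
  exact: pos_cong_contains.
exact: pos_cong_right_cancellative.
Qed.

Lemma W_pos_inj x y : W (pos x) = W (pos y) -> cls x = cls y.
Proof.
move=> /(Inv_word_eq (act_cong_FIM gen T_rc) act_cong_RU_relator) xy.
(* Both words act alike at 1, which [pos x] sends to [cls x] and [pos y] to [cls y]. *)
by have /xy/act_pos := (act_pos x 1 _).2 erefl; rewrite !mul1g.
Qed.

Lemma W_act w x y :
  act gen w (cls x) (cls y) -> W (pos x) * W w = W (pos y).
Proof.
elim: w x => [|[a|a] w IHw] x /=.
- by move=> /W_pos_cls ->; rewrite -WM mulg1.
- by rewrite -clsM => /IHw <-; rewrite posM -!WM -mulgA.
(* Here [cls x = t * gen a], so [W (pos x)] can be written with a last letter [a], which the inverse
   letter cancels. *)
- move=> [t]; have [z ->] := cls_surj t => zx /IHw <-.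
  have <- : W (pos (z ++ [:: a])) = W (pos x) by apply: W_pos_cls; rewrite clsM.
  have -> : W (inr a :: w) = (W (pos [:: a]))^-1 * W w by rewrite -WV -WM.
  by rewrite posM WM mulgA -(mulgA (W (pos z))) W_pos_right_unit mulg1.
Qed.

Lemma right_unit_pos (m : M) : m * m^-1 = 1 -> exists x, m = W (pos x).
Proof.
have [w ->] := Inv_word_surj m; rewrite -/(W w) -WV -WM.
move=> /(Inv_word_eq (act_cong_FIM gen T_rc) act_cong_RU_relator) w1.
(* [w * w^-1] acts as the empty word, so it fixes 1 and [w] is defined there; [t] is the end of its
   path. *)
have /(act_idem gen T_rc)[_ [t]] := (w1 1 1).2 erefl.
have [x ->] := cls_surj t => wx.
by exists x; rewrite -(@W_act w [::] x wx) mul1g.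
Qed.

Definition RU_map (t : T) : right_units M :=
  Sub (W (pos (repr t))) (introT eqP (W_pos_right_unit (repr t))).

Lemma val_RU_map x : val (RU_map (cls x)) = W (pos x).
Proof. by rewrite SubK; apply/W_pos_cls/proj_repr. Qed.

Lemma RU_map_morphism : monoid_morphism RU_map.
Proof.
split; [|move=> p q]; apply: val_inj; first exact: (val_RU_map [::]).
have [x ->] := cls_surj p; have [y ->] := cls_surj q.
by rewrite -clsM val_RU_map posM WM [RHS]valM -!val_RU_map.
Qed.

Lemma RU_map_inj : injective RU_map.
Proof.
move=> p q; have [x ->] := cls_surj p; have [y ->] := cls_surj q.
by move=> /(congr1 val); rewrite !val_RU_map => /W_pos_inj.
Qed.

(** The boolean [==] lets [xchoose] pick preimages in [RU_map_bij]. *)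
Lemma RU_map_surj (m : right_units M) : exists t, RU_map t == m.
Proof.
have /eqP/right_unit_pos[x mx] := valP m.
by exists (cls x); apply/eqP/val_inj; rewrite val_RU_map.
Qed.

Lemma RU_map_bij : bijective RU_map.
Proof.
have surjK : cancel (fun m => xchoose (RU_map_surj m)) RU_map.
  by move=> m; apply/eqP/(xchooseP (RU_map_surj m)).
by eexists; [apply: inj_can_sym surjK RU_map_inj | apply: surjK].
Qed.

End SpecialPresentation.

Theorem theorem5p3 (A I : finType) (u v : I -> word A) :
  RU_monoid (MonRC (relations u v)).
Proof.
exists A, (A + I)%type, (RU_relator u v), (RU_map (u := u) (v := v)); split.
  exact: RU_map_morphism.
exact: RU_map_bij.
Qed.
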